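(* Suppose that $\mathcal{C}\subseteq L^0_{c+}$ is non-empty. For non-empty $\mathcal{Q}\subseteq\mathfrak{P}_c(\Omega)$ let $$\mathcal{C}^\circ_{\mathcal{Q}}:=\{(Q,Z)\in\mathcal{Q}\times L^\infty_{c+}:\forall X\in\mathcal{C}\ \ E_Q[ZX]\le 1\},\qquad \mathcal{C}^{\circ\circ}_{\mathcal{Q}}:=\{X\in L^0_{c+}:\forall (Q,Z)\in\mathcal{C}^\circ_{\mathcal{Q}}\ \ E_Q[ZX]\le 1\},$$ and set $\mathcal{C}^{\circ\circ}:=\mathcal{C}^{\circ\circ}_{\mathfrak{P}_c(\Omega)}$. Then $\mathcal{C}^{\circ\circ}$ is the smallest convex, solid, sequentially order closed, $\mathcal{P}$-sensitive subset of $L^0_{c+}$ containing $\mathcal{C}$. Moreover, $\mathcal{C}=\mathcal{C}^{\circ\circ}$ if and only if $\mathcal{C}$ is convex, solid, sequentially order closed, and $\mathcal{P}$-sensitive. If, moreover, $\mathcal{Q}\subseteq\mathfrak{P}_c(\Omega)$ is a reduction set for $\mathcal{C}$ (in addition to $\mathcal{C}$ being convex, solid, sequentially order closed, and $\mathcal{P}$-sensitive), then $\mathcal{C}=\mathcal{C}^{\circ\circ}=\mathcal{C}^{\circ\circ}_{\mathcal{Q}}$.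
   Context: $(\Omega,\mathcal{F})$ is an arbitrary measurable space, $\mathfrak{P}(\Omega)$ the set of probability measures on it, and $\mathcal{P}\subseteq\mathfrak{P}(\Omega)$ a fixed non-empty set. Put $c[A]:=\sup_{P\in\mathcal{P}}P[A]$, $A\in\mathcal{F}$. An event $A$ is $\mathcal{P}$-polar if $c[A]=0$; a property holds $\mathcal{P}$-q.s. if it holds outside a $\mathcal{P}$-polar event. $\mathfrak{P}_c(\Omega)$ is the set of $Q\in\mathfrak{P}(\Omega)$ with $Q[N]=0$ for every $\mathcal{P}$-polar $N$. $L^0_c$ is the space of real-valued random variables on $(\Omega,\mathcal{F})$ modulo $\mathcal{P}$-q.s. equality, ordered by $X\preccurlyeq Y$ iff $X\le Y$ $\mathcal{P}$-q.s.; $L^\infty_c:=\{X\in L^0_c:\exists m>0\ |X|\preccurlyeq m\}$; $L^0_{c+}$, $L^\infty_{c+}$ are the positive cones. For $Q\in\mathfrak{P}_c(\Omega)$, $E_Q[X]$ for $X\in L^0_c$ is evaluated on any representative (values in $[0,\infty]$ for $X\in L^0_{c+}$). $L^0_Q$ denotes random variables modulo $Q$-a.s. equality, and $j_Q:L^0_c\to L^0_Q$ maps the $\mathcal{P}$-q.s. class of $f$ to its $Q$-a.s. class. $\mathcal{C}\subseteq L^0_c$ is $\mathcal{P}$-sensitive if $\mathcal{C}=\bigcap_{Q\in\mathfrak{P}_c(\Omega)}j_Q^{-1}(j_Q(\mathcal{C}))$. A non-empty $\mathcal{Q}\subseteq\mathfrak{P}_c(\Omega)$ is a reduction set for $\mathcal{C}$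 if $\mathcal{C}=\bigcap_{Q\in\mathcal{Q}}j_Q^{-1}(j_Q(\mathcal{C}))$. $\mathcal{C}\subseteq L^0_{c+}$ is solid if $X\in\mathcal{C}$, $Y\in L^0_{c+}$, $Y\preccurlyeq X$ imply $Y\in\mathcal{C}$. A sequence $(X_n)\subset L^0_c$ is order convergent to $X\in L^0_c$ if there is a decreasing sequence $(Y_n)\subset L^0_c$ with $\inf_n Y_n=0$ in $L^0_c$ and $|X_n-X|\preccurlyeq Y_n$ for all $n$. $\mathcal{C}\subseteq L^0_c$ is sequentially order closed if it contains every $X\in L^0_c$ that is the order limit of a sequence in $\mathcal{C}$. *)

(* Defs.v *)
From HB Require Import structures.
From mathcomp Require Import all_boot all_order all_algebra generic_quotient.
From mathcomp Require Import all_classical all_reals all_analysis measurable_realfun.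

Set Implicit Arguments.
Unset Strict Implicit.
Unset Printing Implicit Defensive.

Import Order.TTheory GRing.Theory Num.Theory.
Import numFieldNormedType.Exports.

Local Open Scope classical_set_scope.
Local Open Scope ring_scope.
Local Open Scope quotient_scope.

Section quasi_sure.
Context {d : measure_display} {Omega : measurableType d} {R : realType}.
Implicit Types (PP : set (probability Omega R)) (A N : set Omega).

Definition upper_probability PP A : \bar R := ereal_sup [set P A | P in PP].

Definition polar PP N := measurable N /\ upper_probability PP N = 0%E.

Definition quasi_surely PP A := exists2 N, polar PP N & ~` N `<=` A.

Definition abs_cont_prob PP : set (probability Omega R) :=
  [set Q | forall N, polar PP N -> Q N = 0%E].

Lemma polarP PP N : PP !=set0 ->
  polar PP N <-> measurable N /\ forall P, PP P -> P N = 0%E.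
Proof.
move=> [P0 PP0]; split=> -[mN N0]; split=> //.
  move=> P PPP; apply/eqP; rewrite eq_le measure_ge0 andbT -N0.
  by apply: ereal_sup_ubound; exists P.
apply/eqP; rewrite eq_le; apply/andP; split.
  by apply: ge_ereal_sup => _ [P PPP <-]; rewrite N0.
by rewrite -(N0 _ PP0); apply: ereal_sup_ubound; exists P0.
Qed.

Lemma quasi_surelyT PP : PP !=set0 -> quasi_surely PP setT.
Proof. by move=> hP; exists set0 => //; apply/polarP => //; split. Qed.

Lemma quasi_surelyS PP A B :
  A `<=` B -> quasi_surely PP A -> quasi_surely PP B.
Proof. by move=> AB [N ? NA]; exists N => //; apply: subset_trans AB. Qed.

Lemma quasi_surelyI PP A B : PP !=set0 ->
  quasi_surely PP A -> quasi_surely PP B -> quasi_surely PP (A `&` B).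
Proof.
move=> hP [M /(polarP _ hP)[mM M0] MA] [N /(polarP _ hP)[mN N0] NB].
exists (M `|` N); last by rewrite setCU => x [/MA ? /NB].
apply/polarP => //; split=> [|P PPP]; first exact: measurableU.
by apply: null_set_setU => //; [exact: M0|exact: N0].
Qed.

End quasi_sure.

(* The proof hP that PP is non-empty is an index of the quotient: for empty PP
   the supremum is -oo, no event is polar and q.s. equality is not reflexive. *)
Section L0c.
Context {d : measure_display} {Omega : measurableType d} {R : realType}.
Context {PP : set (probability Omega R)} (hP : PP !=set0).
Implicit Types (f g h : {mfun Omega >-> R}).

Definition qs_eq f g : bool := `[< quasi_surely PP [set w | f w = g w] >].
Definition qs_le f g : bool := `[< quasi_surely PP [set w | f w <= g w] >].

Lemma qs_eq_refl : reflexive qs_eq.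
Proof.
by move=> f; apply/asboolP; apply: quasi_surelyS (quasi_surelyT hP) => w.
Qed.

Lemma qs_eq_sym : symmetric qs_eq.
Proof.
by move=> f g; apply/asboolP/asboolP; apply: quasi_surelyS => w /=.
Qed.

Lemma qs_eq_trans : transitive qs_eq.
Proof.
move=> g f h /asboolP fg /asboolP gh; apply/asboolP.
by apply: quasi_surelyS (quasi_surelyI hP fg gh) => w /= [->].
Qed.

Definition qs_equiv : equiv_rel {mfun Omega >-> R} :=
  EquivRel qs_eq qs_eq_refl qs_eq_sym qs_eq_trans.

Definition L0c : Type := {eq_quot qs_equiv}.
HB.instance Definition _ := Choice.on L0c.
HB.instance Definition _ := EqQuotient.on L0c.

Definition L0c_to_mfun (X : L0c) : {mfun Omega >-> R} := repr X.
Coercion L0c_to_mfun : L0c >-> MeasurableFun.type.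

Implicit Types (X Y Z : L0c).

Lemma L0cW (A : L0c -> Prop) : (forall f, A (\pi_L0c f)) -> forall X, A X.
Proof. by move=> Af X; rewrite -[X]reprK. Qed.

Lemma L0c_piP f g :
  \pi_L0c f = \pi_L0c g <-> quasi_surely PP [set w | f w = g w].
Proof.
split=> [/eqP|fg]; first by rewrite eqmodE => /asboolP.
by apply/eqP; rewrite eqmodE; apply/asboolP.
Qed.

Lemma L0c_repr_pi f : quasi_surely PP [set w | (\pi_L0c f : L0c) w = f w].
Proof. by apply/L0c_piP; rewrite reprK. Qed.

Definition L0c_zero : L0c := \pi_L0c 0.
Definition L0c_one : L0c := \pi_L0c 1.
Definition L0c_opp X : L0c := \pi_L0c (- (X : {mfun Omega >-> R})).
Definition L0c_add X Y : L0c := \pi_L0c ((X : {mfun Omega >-> R}) + Y).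
Definition L0c_mul X Y : L0c := \pi_L0c ((X : {mfun Omega >-> R}) * Y).
Definition L0c_scale (a : R) X : L0c := \pi_L0c (a *: (X : {mfun Omega >-> R})).

Lemma L0c_pi_opp f : L0c_opp (\pi_L0c f) = \pi_L0c (- f).
Proof.
apply/L0c_piP; apply: quasi_surelyS (L0c_repr_pi f) => w /= fE.
exact: (congr1 -%R fE).
Qed.

Lemma L0c_pi_add f g : L0c_add (\pi_L0c f) (\pi_L0c g) = \pi_L0c (f + g).
Proof.
apply/L0c_piP.
apply: quasi_surelyS (quasi_surelyI hP (L0c_repr_pi f) (L0c_repr_pi g)).
by move=> w /= [fE gE]; exact: (congr2 +%R fE gE).
Qed.

Lemma L0c_pi_mul f g : L0c_mul (\pi_L0c f) (\pi_L0c g) = \pi_L0c (f * g).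
Proof.
apply/L0c_piP.
apply: quasi_surelyS (quasi_surelyI hP (L0c_repr_pi f) (L0c_repr_pi g)).
by move=> w /= [fE gE]; exact: (congr2 *%R fE gE).
Qed.

Lemma L0c_pi_scale a f : L0c_scale a (\pi_L0c f) = \pi_L0c (a *: f).
Proof.
apply/L0c_piP; apply: quasi_surelyS (L0c_repr_pi f) => w /= fE.
exact: (congr1 ( *%R a) fE).
Qed.

Lemma L0c_addA : associative L0c_add.
Proof.
move=> X Y Z; elim/L0cW: X => f; elim/L0cW: Y => g; elim/L0cW: Z => h.
by rewrite !L0c_pi_add addrA.
Qed.

Lemma L0c_addC : commutative L0c_add.
Proof.
by move=> X Y; elim/L0cW: X => f; elim/L0cW: Y => g; rewrite !L0c_pi_add addrC.
Qed.

Lemma L0c_add0 : left_id L0c_zero L0c_add.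
Proof. by move=> X; elim/L0cW: X => f; rewrite L0c_pi_add add0r. Qed.

Lemma L0c_addN : left_inverse L0c_zero L0c_opp L0c_add.
Proof. by move=> X; elim/L0cW: X => f; rewrite L0c_pi_opp L0c_pi_add addNr. Qed.

HB.instance Definition _ :=
  GRing.isZmodule.Build L0c L0c_addA L0c_addC L0c_add0 L0c_addN.

Lemma L0c_mulA : associative L0c_mul.
Proof.
move=> X Y Z; elim/L0cW: X => f; elim/L0cW: Y => g; elim/L0cW: Z => h.
by rewrite !L0c_pi_mul mulrA.
Qed.

Lemma L0c_mulC : commutative L0c_mul.
Proof.
by move=> X Y; elim/L0cW: X => f; elim/L0cW: Y => g; rewrite !L0c_pi_mul mulrC.
Qed.

Lemma L0c_mul1 : left_id L0c_one L0c_mul.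
Proof. by move=> X; elim/L0cW: X => f; rewrite L0c_pi_mul mul1r. Qed.

Lemma L0c_mulDl : left_distributive L0c_mul L0c_add.
Proof.
move=> X Y Z; elim/L0cW: X => f; elim/L0cW: Y => g; elim/L0cW: Z => h.
by rewrite !(L0c_pi_add, L0c_pi_mul) mulrDl.
Qed.

HB.instance Definition _ :=
  GRing.Zmodule_isComPzRing.Build L0c L0c_mulA L0c_mulC L0c_mul1 L0c_mulDl.

Lemma L0c_scaleA a b X : L0c_scale a (L0c_scale b X) = L0c_scale (a * b) X.
Proof. by elim/L0cW: X => f; rewrite !L0c_pi_scale scalerA. Qed.

Lemma L0c_scale1 : left_id 1 L0c_scale.
Proof. by move=> X; elim/L0cW: X => f; rewrite L0c_pi_scale scale1r. Qed.

Lemma L0c_scaleDr : right_distributive L0c_scale +%R.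
Proof.
move=> a X Y; elim/L0cW: X => f; elim/L0cW: Y => g.
by rewrite [X in L0c_scale a X]L0c_pi_add !L0c_pi_scale [RHS]L0c_pi_add scalerDr.
Qed.

Lemma L0c_scaleDl X : {morph L0c_scale^~ X : a b / a + b}.
Proof.
elim/L0cW: X => f a b.
by rewrite /= !L0c_pi_scale [RHS]L0c_pi_add scalerDl.
Qed.

HB.instance Definition _ := GRing.Zmodule_isLmodule.Build R L0c
  L0c_scaleA L0c_scale1 L0c_scaleDr L0c_scaleDl.

Definition L0c_le X Y : bool := qs_le X Y.

Lemma L0c_le_refl : reflexive L0c_le.
Proof.
by move=> X; apply/asboolP; apply: quasi_surelyS (quasi_surelyT hP) => w /=.
Qed.

Lemma L0c_le_anti : antisymmetric L0c_le.
Proof.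
move=> X Y /andP[/asboolP XY /asboolP YX].
suff : \pi_L0c (repr X) = \pi_L0c (repr Y) by rewrite !reprK.
apply/L0c_piP.
apply: quasi_surelyS (quasi_surelyI hP XY YX) => w /= [xy yx].
by apply/eqP; rewrite eq_le xy.
Qed.

Lemma L0c_le_trans : transitive L0c_le.
Proof.
move=> Y X Z /asboolP XY /asboolP YZ; apply/asboolP.
by apply: quasi_surelyS (quasi_surelyI hP XY YZ) => w /= [] /le_trans; apply.
Qed.

HB.instance Definition _ := Order.Le_isPOrder.Build ring_display L0c
  L0c_le_refl L0c_le_anti L0c_le_trans.

Lemma L0c_leP X Y : reflect (quasi_surely PP [set w | X w <= Y w]) (X <= Y).
Proof. exact: asboolP. Qed.

Definition L0c_cst (m : R) : L0c := \pi_L0c (cst m).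
Definition L0c_abs X : L0c :=
  \pi_L0c [the {mfun Omega >-> R} of Num.norm \o X].

Definition L0c_pos : set L0c := [set X | 0 <= X].
Definition Linfty : set L0c :=
  [set X | exists2 m : R, 0 < m & L0c_abs X <= L0c_cst m].
Definition Linfty_pos : set L0c := Linfty `&` L0c_pos.

Definition E_c (Q : probability Omega R) X : \bar R := 'E_Q[X]%E.

Lemma E_c_pi (Q : probability Omega R) f :
  abs_cont_prob PP Q -> E_c Q (\pi_L0c f) = 'E_Q[f]%E.
Proof.
move=> QP; rewrite /E_c unlock; apply: ae_eq_integral => //.
- by apply/measurable_EFinP; exact: measurable_funPT.
- by apply/measurable_EFinP; exact: measurable_funPT.
- have [N pN NE] := L0c_repr_pi f; exists N; split.
  + by case: pN.
  + exact: QP.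
  + move=> w; apply: contra_notP => Nw _.
    by congr (_%:E); exact: NE.
Qed.

Definition L0 (Q : probability Omega R) : Type :=
  {mfun_ Q, Omega >-> R}.

Definition jQ (Q : probability Omega R) (X : L0c) : L0 Q :=
  \pi_{mfun_ Q, Omega >-> R} (repr X).

Implicit Types (C : set L0c) (QQ : set (probability Omega R)).

Definition sensitive C :=
  C = \bigcap_(Q in abs_cont_prob PP) (jQ Q @^-1` (jQ Q @` C)).

Definition reduction_set QQ C :=
  [/\ QQ !=set0, QQ `<=` abs_cont_prob PP &
      C = \bigcap_(Q in QQ) (jQ Q @^-1` (jQ Q @` C))].

Definition solid C := forall X Y, C X -> 0 <= Y -> Y <= X -> C Y.

Definition order_cvg (X_ : nat -> L0c) X :=
  exists Y_ : nat -> L0c, [/\ nonincreasing_seq Y_, infimums (range Y_) 0 &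
    forall n, L0c_abs (X_ n - X) <= Y_ n].

Definition seq_order_closed C := forall (X_ : nat -> L0c) X,
  (forall n, C (X_ n)) -> order_cvg X_ X -> C X.

Definition polar_set QQ C : set (probability Omega R * L0c) :=
  [set QZ | [/\ QQ QZ.1, Linfty_pos QZ.2 &
    forall X, C X -> (E_c QZ.1 (QZ.2 * X)%R <= 1)%E]].

Definition bipolar_set QQ C : set L0c :=
  [set X | L0c_pos X /\
    forall QZ, polar_set QQ C QZ -> (E_c QZ.1 (QZ.2 * X)%R <= 1)%E].

Definition bipolar_class C :=
  [/\ convex_set C, solid C, seq_order_closed C & sensitive C].

End L0c.

Arguments jQ {d Omega R PP hP} Q X.
Arguments L0c_pos {d Omega R PP} hP _.

(* Main.v *)
Require Import Defs.
From mathcomp Require Import all_boot all_order all_algebra generic_quotient.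
From mathcomp Require Import all_classical all_reals all_analysis measurable_realfun.
From mathcomp Require Import ring lra.

Set Implicit Arguments.
Unset Strict Implicit.
Unset Printing Implicit Defensive.

Import Order.TTheory GRing.Theory Num.Theory.
Import numFieldNormedType.Exports.

Local Open Scope classical_set_scope.
Local Open Scope ring_scope.
Local Open Scope quotient_scope.

(* Fix [Q << c], [X >= 0] and let [C] be convex, solid and sequentially order
   closed. In terms of nonnegative representatives, [C] is stable under
   increasing pointwise limits. After dividing by [1 + X] we may assume
   [X <= 1]. A sequence in [C] that lies below [X] and minimises
   [E_Q (X - Y)^2] is Cauchy in [L^2(Q)] by the parallelogram identity; along
   a fast one, the lower limit is again in [C], because lower envelopes only
   need solidity and increasing limits, and it attains the minimum at some
   [Y]. If [X] is not [Q]-a.s. equal to a member of [C], then [Z = X - Y] is a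
   nonnegative bounded density with [E_Q (Z G) <= E_Q (Z Y) < E_Q (Z X)] for
   all [G] in [C], so that a multiple of [(Q, Z)] lies in the polar of [C] and
   excludes [X] from the bipolar. Sensitivity (or a reduction set) provides
   such a [Q] whenever [X] is not in [C]. *)

(** * Integrals of bounded measurable functions under a probability measure *)

Section bounded_expectation.
Context {d : measure_display} {Omega : measurableType d} {R : realType}.
Variable Q : probability Omega R.
Implicit Types (f g x : Omega -> R).

(** This class is stable under the algebraic operations and integrable under any [Q], so that
    [Rintegral] is linear on it without side conditions. *)
Definition bmeas f := measurable_fun setT f /\ exists M, forall w, `|f w| <= M.

Lemma bmeas_integrable f : bmeas f -> Q.-integrable setT (EFin \o f).
Proof.
case=> mf [M fM]; apply: measurable_bounded_integrable => //.
  by rewrite [X in (X < _)%E](@probability_setT _ _ _ Q) ltry.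
exists M; split; first exact: num_real.
by move=> y My w _; apply: le_trans (fM w) (ltW My).
Qed.

Lemma bmeas_cst (a : R) : bmeas (fun=> a).
Proof. by split; [exact: measurable_cst|exists `|a|]. Qed.

Lemma bmeasD f g : bmeas f -> bmeas g -> bmeas (fun w => f w + g w).
Proof.
move=> [mf [M fM]] [mg [N gN]]; split; first exact: measurable_funD.
by exists (M + N) => w; rewrite (le_trans (ler_normD _ _))// lerD.
Qed.

Lemma bmeasM f g : bmeas f -> bmeas g -> bmeas (fun w => f w * g w).
Proof.
move=> [mf [M fM]] [mg [N gN]]; split; first exact: measurable_funM.
by exists (M * N) => w; rewrite normrM ler_pM.
Qed.

Lemma bmeasZ (a : R) f : bmeas f -> bmeas (fun w => a * f w).
Proof. by apply: bmeasM; exact: bmeas_cst. Qed.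

Lemma bmeasB f g : bmeas f -> bmeas g -> bmeas (fun w => f w - g w).
Proof.
move=> bf bg; have := bmeasD bf (bmeasZ (-1) bg); congr bmeas.
by apply/funext => w; rewrite mulN1r.
Qed.

Lemma bmeasX f n : bmeas f -> bmeas (fun w => f w ^+ n).
Proof.
move=> bf; elim: n => [|n ih]; first exact: bmeas_cst.
by have := bmeasM bf ih; congr bmeas; apply/funext => w; rewrite exprS.
Qed.

Lemma bmeas_norm f : bmeas f -> bmeas (fun w => `|f w|).
Proof.
move=> [mf [M fM]]; split; first exact: measurableT_comp.
by exists M => w; rewrite normr_id.
Qed.

Lemma bmeas_itv f M : measurable_fun setT f ->
  (forall w, 0 <= f w) -> (forall w, f w <= M) -> bmeas f.
Proof. by move=> mf f0 fM; split=> //; exists M => w; rewrite ger0_norm. Qed.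

Lemma bmeas_ED f g : bmeas f -> bmeas g ->
  (\int[Q]_w (f w + g w) = \int[Q]_w f w + \int[Q]_w g w)%R.
Proof. by move=> bf bg; rewrite RintegralD//; exact: bmeas_integrable. Qed.

Lemma bmeas_EB f g : bmeas f -> bmeas g ->
  (\int[Q]_w (f w - g w) = \int[Q]_w f w - \int[Q]_w g w)%R.
Proof. by move=> bf bg; rewrite RintegralB//; exact: bmeas_integrable. Qed.

Lemma bmeas_EZ a f : bmeas f -> (\int[Q]_w (a * f w) = a * \int[Q]_w f w)%R.
Proof. by move=> bf; rewrite RintegralZl//; exact: bmeas_integrable. Qed.

Lemma bmeas_Ele f g : bmeas f -> bmeas g -> (forall w, f w <= g w) ->
  (\int[Q]_w f w <= \int[Q]_w g w)%R.
Proof.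
by move=> bf bg fg; apply: le_Rintegral => //; exact: bmeas_integrable.
Qed.

Lemma E_cst (a : R) : (\int[Q]_w a = a)%R.
Proof. by rewrite Rintegral_cst// [X in fine X](@probability_setT _ _ _ Q) mulr1. Qed.

Lemma bmeas_EFin f : bmeas f ->
  (\int[Q]_w (f w)%:E)%E = ((\int[Q]_w f w)%R)%:E.
Proof.
move=> bf; rewrite /Rintegral fineK//.
exact: integrable_fin_num (bmeas_integrable bf).
Qed.

(** Dominated convergence with the constant [M] as dominating function. *)
Lemma bounded_cvg_E (u : nat -> Omega -> R) f M :
  (forall n, measurable_fun setT (u n)) -> (forall n w, `|u n w| <= M) ->
  (forall w, u n w @[n --> \oo] --> f w) ->
  (\int[Q]_w u n w)%R @[n --> \oo] --> (\int[Q]_w f w)%R.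
Proof.
move=> mu uM uf.
have bu n : bmeas (u n) by split=> //; exists M.
have bf : bmeas f.
  split; first by apply: (measurable_fun_cvg mu) => w _; exact: uf.
  exists M => w; apply: cvgr_to_le (cvg_norm (uf w)) _.
  by apply: nearW => n; exact: uM.
apply: fine_cvg; rewrite -/(Rintegral _ _ _) -bmeas_EFin//.
apply: (@dominated_cvg _ _ _ Q setT _ _ _ (cst M%:E)) => //.
- by move=> n; apply/measurable_EFinP; exact: mu.
- by move=> w _; apply: cvg_EFin; [exact: nearW|exact: uf].
- have := bmeas_integrable (bmeas_cst M); exact.
- by move=> n w _; rewrite /= lee_fin.
Qed.

End bounded_expectation.

(** The properties of [C] carried over to genuine functions, so that the projection is free of null
    sets. Only increasing limits are required: decreasing ones are covered by solidity. *)
Record monotone_closed_convex {d : measure_display} {Omega : measurableType d}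
    {R : realType} (K : set (Omega -> R)) : Prop := MonotoneClosedConvex {
  mccM : forall f, K f -> measurable_fun setT f ;
  mcc_ge0 : forall f, K f -> forall w, 0 <= f w ;
  mcc_convex : forall (f g : Omega -> R) (t : R), K f -> K g -> 0 <= t -> t <= 1 ->
    K (fun w => t * f w + (1 - t) * g w) ;
  mcc_solid : forall f g : Omega -> R, K f -> measurable_fun setT g ->
    (forall w, 0 <= g w) -> (forall w, g w <= f w) -> K g ;
  mcc_closed : forall (u : nat -> Omega -> R) f, (forall n, K (u n)) ->
    (forall w, nondecreasing_seq (u^~ w)) ->
    (forall w, u n w @[n --> \oo] --> f w) -> K f }.

(** * Projection in $L^2(Q)$ of a function [x <= 1] onto the members of [K] below it *)

Section projection.
Context {d : measure_display} {Omega : measurableType d} {R : realType}.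
Variables (Q : probability Omega R) (K : set (Omega -> R)) (x : Omega -> R).
Implicit Types (f g : Omega -> R).
Hypotheses (Kmcc : monotone_closed_convex K) (K_neq0 : K !=set0).
Hypotheses (mx : measurable_fun setT x).
Hypotheses (x_ge0 : forall w, 0 <= x w) (x_le1 : forall w, x w <= 1).

Let J (g : Omega -> R) : R := (\int[Q]_w (x w - g w) ^+ 2)%R.
(** Competitors lie between [0] and [x <= 1], so that all integrands are bounded. *)
Let D := [set g | K g /\ forall w, g w <= x w].

Let bx : bmeas x. Proof. exact: bmeas_itv x_le1. Qed.

Let bD g : D g -> bmeas g.
Proof.
move=> [Kg gx]; apply: (@bmeas_itv _ _ _ _ 1).
- exact: mccM Kg.
- exact: mcc_ge0 Kg.
- by move=> w; exact: le_trans (gx w) (x_le1 w).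
Qed.

Let bDx g : D g -> bmeas (fun w => (x w - g w) ^+ 2).
Proof. by move=> Dg; exact/bmeasX/bmeasB/bD. Qed.

Let D_min f g : D f -> measurable_fun setT g -> (forall w, 0 <= g w) ->
  D (fun w => Num.min (f w) (g w)).
Proof.
move=> [Kf fx] mg g0; split; last first.
  by move=> w; rewrite ge_min fx.
apply: (mcc_solid Kmcc Kf).
- by apply: measurable_minr => //; exact: mccM Kf.
- by move=> w; rewrite le_min g0 (mcc_ge0 Kmcc Kf).
- by move=> w; rewrite ge_min lexx.
Qed.

Lemma min_in_below g : K g -> D (fun w => Num.min (g w) (x w)).
Proof.
move=> Kg; split; last by move=> w; rewrite ge_min lexx orbT.
apply: (mcc_solid Kmcc Kg).
- by apply: measurable_minr => //; exact: mccM Kg.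
- by move=> w; rewrite le_min x_ge0 (mcc_ge0 Kmcc Kg).
- by move=> w; rewrite ge_min lexx.
Qed.

Let D0 : D !=set0.
Proof. by case: K_neq0 => g /min_in_below Dg; eexists; exact: Dg. Qed.

Let J_ge0 g : 0 <= J g.
Proof. by apply: Rintegral_ge0 => w _; exact: sqr_ge0. Qed.

Let m := inf [set J g | g in D].

Let m_le g : D g -> m <= J g.
Proof.
by move=> Dg; apply: ge_inf; [exists 0 => _ [h _ <-]|exists g].
Qed.

Let e (n : nat) : R := 2^-1 ^+ n.

Let e_gt0 n : 0 < e n. Proof. by rewrite exprn_gt0// invr_gt0. Qed.

Let eS n : e n.+1 = e n / 2. Proof. by rewrite /e exprSr. Qed.

Let e_le1 n : e n <= 1.
Proof. by rewrite exprn_ile1// ?invr_ge0// invf_le1// ler1n. Qed.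

(** The tolerance is squared because the parallelogram identity controls squared distances:
    near-minimisers are then within order [e n] in $L^1(Q)$, which is summable. *)
Let near_min n : exists g, D g /\ J g <= m + e n ^+ 2.
Proof.
have [] := @inf_adherent _ [set J g | g in D] (e n ^+ 2).
- by rewrite exprn_gt0.
- by split; [case: D0 => g Dg; exists (J g), g|exists 0 => _ [h _ <-]].
- by move=> _ [g Dg <-] Jg; exists g; split=> //; exact: ltW.
Qed.

(* Parallelogram identity:
   [(f - g)^2 = 2 (x - f)^2 + 2 (x - g)^2 - 4 (x - (f + g) / 2)^2]. *)
Let sqr_dist f g n : D f -> D g -> J f <= m + e n ^+ 2 -> J g <= m + e n ^+ 2 ->
  (\int[Q]_w (f w - g w) ^+ 2 <= 4 * e n ^+ 2)%R.
Proof.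
move=> Df Dg Jf Jg.
pose h w := 2^-1 * f w + (1 - 2^-1) * g w.
have Dh : D h.
  split; first by apply: mcc_convex => //; [case: Df|case: Dg|lra..].
  by move=> w; have := Df.2 w; have := Dg.2 w; rewrite /h; lra.
have -> : (\int[Q]_w (f w - g w) ^+ 2 = 2 * J f + 2 * J g - 4 * J h)%R.
  rewrite -!bmeas_EZ//; try exact: bDx.
  rewrite -bmeas_ED; try exact/bmeasZ/bDx.
  rewrite -bmeas_EB; try exact/bmeasZ/bDx.
  - by congr Rintegral; apply/funext => w; rewrite /h; field.
  - by apply: bmeasD; exact/bmeasZ/bDx.
by have := m_le Dh; lra.
Qed.

(* AM-GM: [|t| <= (e + t^2 / e) / 2]. *)
Let abs_dist f g n : D f -> D g -> J f <= m + e n ^+ 2 -> J g <= m + e n ^+ 2 ->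
  (\int[Q]_w `|f w - g w| <= 3 * e n)%R.
Proof.
move=> Df Dg Jf Jg.
have bfg : bmeas (fun w => f w - g w) by apply: bmeasB; exact: bD.
have bfg2 := bmeasX 2 bfg.
have := sqr_dist Df Dg Jf Jg; set s := (X in X <= _) => sle.
apply: (@le_trans _ _ (\int[Q]_w (2^-1 * e n + (2^-1 / e n) * (f w - g w) ^+ 2))%R).
  apply: bmeas_Ele; first exact: bmeas_norm.
    by apply: bmeasD; [exact: bmeas_cst|exact: bmeasZ].
  move=> w; rewrite -(real_normK (num_real (f w - g w))).
  set t := `|_|; rewrite -subr_ge0.
  have -> : 2^-1 * e n + 2^-1 / e n * t ^+ 2 - t = (e n - t) ^+ 2 / (2 * e n).
    by field; rewrite gt_eqF.
  by rewrite divr_ge0// ?sqr_ge0// mulr_ge0// ltW.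
rewrite bmeas_ED; [|exact: bmeas_cst|exact: bmeasZ].
rewrite E_cst bmeas_EZ// -/s.
have : 2^-1 / e n * s <= 2^-1 / e n * (4 * e n ^+ 2).
  by rewrite ler_wpM2l// divr_ge0// ltW.
have -> : 2^-1 / e n * (4 * e n ^+ 2) = 2 * e n by field; rewrite gt_eqF.
have := e_gt0 n; lra.
Qed.

Let cvg_e : e n @[n --> \oo] --> (0 : R).
Proof. by apply: cvg_expr; rewrite ger0_norm ?invr_ge0// invf_lt1// ltr1n. Qed.

(** The minimiser is the lower limit of a fast minimising sequence. Summable distances keep the tail
    infima nearly minimal, and the increasing limit of these infima stays in [K]. *)
Lemma projection : exists y, [/\ K y, forall w, y w <= x w &
  forall g, K g -> (forall w, g w <= x w) ->
  (\int[Q]_w (x w - y w) ^+ 2 <= \int[Q]_w (x w - g w) ^+ 2)%R].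
Proof.
have [y y_min] := choice near_min.
have Dy n : D (y n) by case: (y_min n).
(* [V n k] is the minimum of [y n], ..., [y (n + k)]. *)
pose fix V n k : Omega -> R :=
  if k is k'.+1 then fun w => Num.min (V n k' w) (y (n + k').+1 w) else y n.
have DV n k : D (V n k).
  elim: k => [|k ih] //=; apply: D_min => //.
    by apply: (mccM Kmcc); case: (Dy (n + k).+1).
  by apply: (mcc_ge0 Kmcc); case: (Dy (n + k).+1).
have V_le n k w : V n k w <= y (n + k)%N w.
  by case: k => [|k] /=; rewrite ?addn0// addnS ge_min lexx orbT.
have V_ge0 n k w : 0 <= V n k w by have := mcc_ge0 Kmcc (DV n k).1.
have V_dec n w : nonincreasing_seq (fun k => V n k w).
  by apply/nonincreasing_seqP => k /=; rewrite ge_min lexx.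
(* One more term lowers the minimum by at most [|y (n + k) - y (n + k).+1|], of integral at most
   [3 * e (n + k)]; the geometric series sums to this bound. *)
have EV n k : (\int[Q]_w (y n w - V n k w) <= 6 * e n * (1 - e k))%R.
  elim: k => [|k ih].
    rewrite /e expr0 subrr mulr0 (_ : (fun w => _) = cst 0) ?E_cst//.
    by apply/funext => w; rewrite subrr.
  apply: le_trans (_ : (\int[Q]_w ((y n w - V n k w) +
      `|y (n + k)%N w - y (n + k).+1 w|) <= _)%R).
    apply: bmeas_Ele.
    - by apply: bmeasB; exact: bD.
    - by apply: bmeasD; [|apply: bmeas_norm]; apply: bmeasB; exact: bD.
    - move=> w /=; have := V_le n k w.
      have := ler_norm (y (n + k)%N w - y (n + k).+1 w).
      by have := normr_ge0 (y (n + k)%N w - y (n + k).+1 w);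
        rewrite /Num.min; case: ifP => _; lra.
  rewrite bmeas_ED; first last.
  - by apply: bmeas_norm; apply: bmeasB; exact: bD.
  - by apply: bmeasB; exact: bD.
  have : (\int[Q]_w `|y (n + k)%N w - y (n + k).+1 w| <= 3 * e (n + k))%R.
    apply: abs_dist => //; first by case: (y_min (n + k)%N).
    case: (y_min (n + k).+1) => _ /le_trans; apply; rewrite lerD2l.
    rewrite lerXn2r// ?nnegrE ?(ltW (e_gt0 _))// eS.
    by have := e_gt0 (n + k); lra.
  have -> : e (n + k) = e n * e k by rewrite /e exprD.
  rewrite eS; move: ih; set a := (\int[Q]__ _)%R; set b := (\int[Q]__ _)%R.
  have -> : 6 * e n * (1 - e k / 2) = 6 * e n * (1 - e k) + 3 * (e n * e k) by field.
  lra.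
(* For values in [[0, 1]] with $V \le y$, $(x - V)^2 \le (x - y)^2 + 2 (y - V)$. The constant is
   [13 = 1 + 2 * 6], using [e n ^+ 2 <= e n]. *)
have JV n k : J (V n k) <= m + 13 * e n.
  apply: le_trans (_ : (\int[Q]_w ((x w - y n w) ^+ 2 + 2 * (y n w - V n k w)) <= _)%R).
    apply: bmeas_Ele; first exact: bDx.
      by apply: bmeasD; [exact: bDx|apply: bmeasZ; apply: bmeasB; exact: bD].
    move=> w; have := V_dec n w 0%N k (leq0n k); have /= := V_ge0 n k w.
    have := (Dy n).2 w; have := x_le1 w; have := (DV n k).2 w.
    move: (x w) (y n w) (V n k w) => a b c ac a1 ab c0 cb.
    rewrite -subr_ge0.
    have -> : (a - b) ^+ 2 + 2 * (b - c) - (a - c) ^+ 2 =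
      (b - c) * ((1 - a) + (1 - a) + b + c) by ring.
    by apply: mulr_ge0; lra.
  rewrite bmeas_ED//; [|exact: bDx|apply: bmeasZ; apply: bmeasB; exact: bD].
  rewrite bmeas_EZ; last by apply: bmeasB; exact: bD.
  have := EV n k; have := (y_min n).2; rewrite -/(J (y n)).
  have : e n ^+ 2 <= e n by rewrite expr2 ler_piMr// ltW.
  have : 6 * e n * (1 - e k) <= 6 * e n.
    apply: ler_piMr; first by rewrite mulr_ge0// ltW.
    by have := e_gt0 k; lra.
  lra.
(* [U n] is the infimum of the tail [y n], [y n.+1], ...; it belongs to [K] by solidity, being below
   [y n]. *)
pose U n w := inf (range (fun k => V n k w)).
have lbV n w : has_lbound (range (fun k => V n k w)) by exists 0 => _ [k _ <-].
have VU n w : V n k w @[k --> \oo] --> U n w by exact: nonincreasing_cvgn.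
have U_le n k w : U n w <= V n k w by apply: ge_inf => //; exists k.
have U_ge a n w : (forall k, a <= V n k w) -> a <= U n w.
  by move=> aV; apply: lb_le_inf; [exists (V n 0%N w), 0%N|move=> _ [k _ <-]].
have KU n : K (U n).
  apply: (mcc_solid Kmcc (Dy n).1) => [|w|w].
  - by apply: (measurable_fun_cvg (fun k => mccM Kmcc (DV n k).1)) => w _.
  - exact: U_ge.
  - exact: (U_le n 0%N).
have Ux n w : U n w <= x w by apply: le_trans (U_le n 0%N w) _; exact: (Dy n).2.
have DU n : D (U n) by split.
have JU n : J (U n) <= m + 13 * e n.
  have c : J (V n k) @[k --> \oo] --> J (U n).
    apply: (@bounded_cvg_E _ _ _ _ _ _ 1) => [k|k w|w].
    - by have [] := bDx (DV n k).
    - have := (DV n k).2 w; have := x_le1 w; have := V_ge0 n k w.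
      move=> V0 x1 Vx; rewrite ger0_norm ?sqr_ge0// expr_le1//; lra.
    - have c : x w - V n k w @[k --> \oo] --> x w - U n w.
        by apply: cvgB; [exact: cvg_cst|exact: VU].
      exact: (cvgM c c).
  by apply: cvgr_to_le c _; exact: nearW.
(* Dropping [y n] can only raise the minimum: [V n k.+1 <= V n.+1 k]. *)
have U_inc w : nondecreasing_seq (U^~ w).
  apply/nondecreasing_seqP => n; apply: U_ge => k.
  apply: le_trans (U_le n k.+1 w) _; elim: k => [|k ih].
    by rewrite /= addn0 ge_min lexx orbT.
  rewrite [leRHS]/= le_min; apply/andP; split.
    by apply: le_trans ih; exact: V_dec.
  by apply: le_trans (V_le n k.+2 w) _; rewrite addnS addSn addnS.
(* [Z] is the lower limit of [y], reached from below by the increasing [U n]. *)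
pose Z w := sup (range (U^~ w)).
have ubU w : has_ubound (range (U^~ w)) by exists (x w) => _ [n _ <-].
have UZ w : U n w @[n --> \oo] --> Z w by exact: nondecreasing_cvgn.
have KZ : K Z by exact: mcc_closed UZ.
have Zx w : Z w <= x w.
  by apply: ge_sup; [exists (U 0%N w), 0%N|move=> _ [n _ <-]].
have DZ : D Z by split.
exists Z; split=> // g Kg gx; rewrite -/(J Z) -/(J g).
apply: (@le_trans _ _ m); last exact: m_le.
(* Since [U n <= Z <= x], [J Z <= J (U n) <= m + 13 * e n], and this bound tends to [m]. *)
have c : m + 13 * e n @[n --> \oo] --> m + 13 * 0.
  by apply: cvgD; [exact: cvg_cst|apply: cvgM => //; exact: cvg_cst].
rewrite mulr0 addr0 in c; apply: cvgr_to_ge c _; apply: nearW => n.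
apply: le_trans (JU n); apply: bmeas_Ele; [exact: bDx..|move=> w].
have UZw : U n w <= Z w by apply: ub_le_sup => //; exists n.
by rewrite lerXn2r// ?nnegrE ?subr_ge0// lerB.
Qed.

End projection.

(** * Separation of a function from [K] by a bounded density *)

Section separation.
Context {d : measure_display} {Omega : measurableType d} {R : realType}.
Variable Q : probability Omega R.
Implicit Types (K : set (Omega -> R)) (f g x y z : Omega -> R).

(** Monotone convergence along the truncations of [g] at [n], which reduces the bound to bounded
    functions. *)
Lemma ge0_integralM_le (z g : Omega -> R) (a : R) :
  measurable_fun setT z -> measurable_fun setT g ->
  (forall w, 0 <= z w) -> (forall w, 0 <= g w) ->
  (forall n : nat, \int[Q]_w (z w * Num.min (g w) n%:R)%:E <= a%:E)%E ->
  (\int[Q]_w (z w * g w)%:E <= a%:E)%E.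
Proof.
move=> mz mg z0 g0 le_a.
pose u (n : nat) w := (z w * Num.min (g w) n%:R)%:E.
have uE w : u n w @[n --> \oo] --> (z w * g w)%:E.
  apply: cvg_near_cst; near=> n; rewrite /u min_l//.
  by near: n; exact: nbhs_infty_ger.
have -> : (\int[Q]_w (z w * g w)%:E = \int[Q]_w limn (u^~ w))%E.
  by apply: eq_integral => w _; apply/esym/cvg_lim.
rewrite monotone_convergence//.
- apply: lime_le; last by apply: nearW => n; exact: le_a.
  apply: ereal_nondecreasing_is_cvgn; apply/nondecreasing_seqP => n.
  apply: ge0_le_integral => //.
  + by move=> w _; rewrite lee_fin mulr_ge0// le_min g0 ler0n.
  + by apply/measurable_EFinP/measurable_funM => //; exact: measurable_minr.
  + by apply/measurable_EFinP/measurable_funM => //; exact: measurable_minr.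
  + move=> w _; rewrite lee_fin ler_wpM2l// le_min !ge_min lexx/=.
    by rewrite ler_nat leqnSn orbT.
- by move=> n; apply/measurable_EFinP/measurable_funM => //; exact: measurable_minr.
- by move=> n w _; rewrite lee_fin mulr_ge0// le_min g0 ler0n.
- move=> w _; apply/nondecreasing_seqP => n.
  by rewrite lee_fin ler_wpM2l// le_min !ge_min lexx/= ler_nat leqnSn orbT.
Unshelve. all: by end_near. Qed.

(** The level [1] is that of the polar: such a density, paired with [Q], lies in the polar of [K]
    and excludes [x] from the bipolar. *)
Definition separates z K x := [/\ measurable_fun setT z, (forall w, 0 <= z w),
  exists M, forall w, z w <= M,
  forall g, K g -> (\int[Q]_w (z w * g w)%:E <= 1)%E &
  (1 < \int[Q]_w (z w * x w)%:E)%E].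

(** The density is a multiple of the residual [x - y] of the projection [y]: the first-order
    optimality condition bounds its integral against [K] by that against [y]. A null residual gives
    the first alternative. *)
Lemma separation_le1 K x : monotone_closed_convex K -> K !=set0 ->
  measurable_fun setT x -> (forall w, 0 <= x w) -> (forall w, x w <= 1) ->
  (exists2 y, K y & {ae Q, forall w, y w = x w}) \/
  (exists z, separates z K x).
Proof.
move=> Kmcc K_neq0 mx x_ge0 x_le1.
have [y [Ky yx ymin]] := projection Q Kmcc K_neq0 mx x_ge0 x_le1.
have my := mccM Kmcc Ky; have y_ge0 := mcc_ge0 Kmcc Ky.
have bx : bmeas x by exact: bmeas_itv x_le1.
have by_ : bmeas y.
  by apply: (@bmeas_itv _ _ _ _ 1) => // w; exact: le_trans (yx w) _.
pose z w := x w - y w.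
have z_ge0 w : 0 <= z w by rewrite subr_ge0.
have z_le1 w : z w <= 1 by have := y_ge0 w; have := x_le1 w; rewrite /z; lra.
have bz : bmeas z by exact: bmeasB.
have [z2|z2_neq0] := eqVneq (\int[Q]_w z w ^+ 2)%R 0.
  left; exists y => //.
  have : (\int[Q]_w `|(z w ^+ 2)%:E| = 0)%E.
    under eq_integral do rewrite gee0_abs ?lee_fin ?sqr_ge0//.
    by rewrite bmeas_EFin ?z2//; exact: bmeasX.
  move/(ae_eq_integral_abs _ measurableT) => /(_ _).
  have mz2 : measurable_fun setT (fun w => (z w ^+ 2)%:E).
    by apply/measurable_EFinP; have [] := bmeasX 2 bz.
  move=> /(_ mz2); apply: filterS => w /(_ I) /= [] /eqP.
  by rewrite sqrf_eq0 subr_eq0 => /eqP.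
right.
have z2_gt0 : 0 < (\int[Q]_w z w ^+ 2)%R.
  by rewrite lt_neqAle eq_sym z2_neq0 Rintegral_ge0// => w _; exact: sqr_ge0.
set a := (\int[Q]_w (z w * y w))%R.
have a_ge0 : 0 <= a by apply: Rintegral_ge0 => w _; rewrite mulr_ge0.
(* Variational inequality at the minimiser, tested along the segment from [y] to [g]. *)
have le_a g : K g -> bmeas g -> (\int[Q]_w (z w * g w) <= a)%R.
  move=> Kg bg.
  have bh : bmeas (fun w => g w - y w) by exact: bmeasB.
  set A := (\int[Q]_w (z w * (g w - y w)))%R.
  have -> : (\int[Q]_w (z w * g w) = A + a)%R.
    rewrite -bmeas_ED; try exact: bmeasM.
    by congr Rintegral; apply/funext => w; ring.
  rewrite gerDr leNgt; apply/negP => A_gt0.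
  set B := (\int[Q]_w (g w - y w) ^+ 2)%R.
  have B_ge0 : 0 <= B by apply: Rintegral_ge0 => w _; exact: sqr_ge0.
  have AtB t : 0 < t -> t <= 1 -> 2 * A <= t * B.
    move=> t_gt0 t_le1.
    pose h w := t * g w + (1 - t) * y w.
    have Kh : K h by apply: mcc_convex => //; exact: ltW.
    (* [h] may exceed [x]. Truncating it at [x] makes it a competitor and takes it no farther from
       [x]. *)
    have [Kh' h'x] := min_in_below Kmcc mx x_ge0 Kh.
    have := ymin _ Kh' h'x; rewrite -/(z _).
    have bxh : bmeas (fun w => x w - h w).
      by apply: bmeasB => //; apply: bmeasD; exact: bmeasZ.
    have bxh' : bmeas (fun w => x w - Num.min (h w) (x w)).
      apply: bmeasB => //; apply: (@bmeas_itv _ _ _ _ 1).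
      - exact: mccM Kh'.
      - exact: mcc_ge0 Kh'.
      - by move=> w; exact: le_trans (h'x w) _.
    move=> /le_trans /(_ (bmeas_Ele Q (bmeasX 2 bxh') (bmeasX 2 bxh) _)).
    have le_h w : (x w - Num.min (h w) (x w)) ^+ 2 <= (x w - h w) ^+ 2.
      rewrite /Num.min; case: ifP => //= _.
      by rewrite subrr expr0n sqr_ge0.
    move=> /(_ le_h).
    (* Expansion of the square of [x - h], which is [z - t * (g - y)]; minimality and division by
       [t] then give [2 * A <= t * B]. *)
    have -> : (\int[Q]_w (x w - h w) ^+ 2 =
        \int[Q]_w (x w - y w) ^+ 2 - t * (2 * A - t * B))%R.
      have b2 := bmeasZ 2 (bmeasM bz bh); have bt := bmeasZ t (bmeasX 2 bh).
      rewrite -(bmeas_EZ Q 2 (bmeasM bz bh)) -(bmeas_EZ Q t (bmeasX 2 bh)).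
      rewrite -(bmeas_EB Q b2 bt) -(bmeas_EZ Q t (bmeasB b2 bt)).
      rewrite -(bmeas_EB Q (bmeasX 2 bz) (bmeasZ t (bmeasB b2 bt))).
      by congr Rintegral; apply/funext => w; rewrite /h /z; ring.
    rewrite lerBrDr gerDl pmulr_rle0// subr_le0; exact.
  have AB : 0 < A + B + 1 by lra.
  (* This [t] lies in []0, 1]] and gives [t * B < A], against [2 * A <= t * B]. *)
  have := AtB (A / (A + B + 1)).
  rewrite divr_gt0// ler_pdivrMr// mul1r => /(_ isT); rewrite -addrA lerDl.
  rewrite (_ : 0 <= B + 1); last by lra.
  move=> /(_ isT); rewrite mulrAC ler_pdivlMr ?addrA//.
  apply/negP; rewrite -ltNge.
  have : 0 < A * A by rewrite mulr_gt0.
  have : 0 <= A * B by rewrite mulr_ge0// ltW.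
  nra.
set s := (\int[Q]_w z w ^+ 2)%R in z2_gt0 *.
have zx : (\int[Q]_w (z w * x w) = a + s)%R.
  rewrite -bmeas_ED; [|exact: bmeasM|exact: bmeasX].
  by congr Rintegral; apply/funext => w; rewrite /z; ring.
(* Midpoint of [a], which bounds the integrals against bounded members of [K], and [a + s], the
   integral of [z * x]. Halving [s] keeps the separation strict and [b] positive even if [a = 0]. *)
pose b := a + s / 2.
have b_gt0 : 0 < b by rewrite /b; lra.
exists (fun w => b^-1 * z w); split.
- by apply: measurable_funM => //; have [] := bz.
- by move=> w; rewrite mulr_ge0// invr_ge0 ltW.
- by exists b^-1 => w; rewrite ler_piMr// invr_ge0 ltW.
- move=> g Kg; have g_ge0 := mcc_ge0 Kmcc Kg; have mg := mccM Kmcc Kg.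
  apply: ge0_integralM_le => //.
  + by apply: measurable_funM => //; have [] := bz.
  + by move=> w; rewrite mulr_ge0// invr_ge0 ltW.
  move=> n; have min_ge0 w : 0 <= Num.min (g w) n%:R by rewrite le_min g_ge0 ler0n.
  have mmin : measurable_fun setT (fun w => Num.min (g w) n%:R).
    exact: measurable_minr.
  have Kmin : K (fun w => Num.min (g w) n%:R).
    by apply: (mcc_solid Kmcc Kg) => // w; rewrite ge_min lexx.
  have bmin : bmeas (fun w => Num.min (g w) n%:R).
    by apply: (@bmeas_itv _ _ _ _ n%:R) => // w; rewrite ge_min lexx orbT.
  under eq_integral do rewrite -mulrA.
  rewrite bmeas_EFin; last by apply: bmeasZ; exact: bmeasM.
  rewrite bmeas_EZ; last exact: bmeasM.
  rewrite lee_fin ler_pdivrMl// mulr1 (le_trans (le_a _ Kmin bmin))//.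
  by rewrite /b; lra.
- under eq_integral do rewrite -mulrA.
  rewrite bmeas_EFin; last by apply: bmeasZ; exact: bmeasM.
  rewrite bmeas_EZ; last exact: bmeasM.
  by rewrite zx lte_fin ltr_pdivlMl// mulr1 /b; lra.
Qed.

(* Reduction to the bounded case by the change of density [f |-> f / (1 + x)]. *)
Lemma separation K x : monotone_closed_convex K -> K !=set0 ->
  measurable_fun setT x -> (forall w, 0 <= x w) ->
  (exists2 y, K y & {ae Q, forall w, y w = x w}) \/
  (exists z, separates z K x).
Proof.
move=> Kmcc [y0 Ky0] mx x_ge0.
pose r w := 1 + x w.
have r_gt0 w : 0 < r w by rewrite /r; have := x_ge0 w; lra.
have r_neq0 w : r w != 0 by rewrite gt_eqF.
have mr : measurable_fun setT r by exact: measurable_funD.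
have mV : measurable_fun setT (fun w => (r w)^-1).
  (* Replaces inversion by a function continuous on the whole line that agrees with it on [[1,
     +oo[], where [r] takes its values. *)
  pose iv (t : R) := (Num.max t 1)^-1.
  have mi : measurable_fun setT iv.
    apply: continuous_measurable_fun => t.
    apply: cvgV; first by rewrite gt_eqF// lt_max ltr01 orbT.
    by apply: continuous_max; [exact: cvg_id|exact: cvg_cst].
  apply: eq_measurable_fun (measurableT_comp mi mr) => w _ /=.
  by rewrite /iv max_l// /r lerDl.
(* [K'] consists of the quotients [g / (1 + x)] with [g] in [K]; [x] itself becomes
   [x / (1 + x) <= 1]. *)
pose K' := [set f : Omega -> R | measurable_fun setT f /\ K (fun w => f w * r w)].
have K'D g : K g -> K' (fun w => g w * (r w)^-1).
  move=> Kg; split; first by apply: measurable_funM => //; exact: mccM Kg.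
  by congr (K _) : Kg; apply/funext => w; rewrite mulfVK.
have mcc' : monotone_closed_convex K'.
  split.
  - by move=> f [].
  - by move=> f [_ Kf] w; have := mcc_ge0 Kmcc Kf w; rewrite pmulr_lge0.
  - move=> f g t [mf Kf] [mg Kg] t0 t1; split.
      by apply: measurable_funD; exact: measurable_funM.
    have := mcc_convex Kmcc Kf Kg t0 t1; congr (K _).
    by apply/funext => w; ring.
  - move=> f g [mf Kf] mg g0 gf; split=> //.
    apply: (mcc_solid Kmcc Kf) => [|w|w]; first exact: measurable_funM.
      by rewrite mulr_ge0// ltW.
    by rewrite ler_wpM2r// ltW.
  - move=> u f Ku u_inc uf; split.
      by apply: (measurable_fun_cvg (fun n => (Ku n).1)) => w _; exact: uf.
    apply: (mcc_closed Kmcc (fun n => (Ku n).2)) => [w m n mn|w].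
      by rewrite ler_wpM2r ?(ltW (r_gt0 w))//; exact: u_inc.
    by apply: cvgM; [exact: uf|exact: cvg_cst].
have mx' : measurable_fun setT (fun w => x w * (r w)^-1) by exact: measurable_funM.
case: (@separation_le1 K' (fun w => x w * (r w)^-1)) => //.
- by eexists; exact: K'D Ky0.
- by move=> w; rewrite mulr_ge0// invr_ge0 ltW.
- by move=> w; rewrite ler_pdivrMr// mul1r /r; lra.
- move=> [y [my Ky] yx]; left; exists (fun w => y w * r w) => //.
  by apply: filterS yx => w /= ->; rewrite mulfVK.
(* The factor [1 / r] moves from [g] to the density, which stays bounded because [r >= 1]. *)
- move=> [z [mz z_ge0 [M zM] le1 gt1]]; right; exists (fun w => z w * (r w)^-1); split.
  + exact: measurable_funM.
  + by move=> w; rewrite mulr_ge0// invr_ge0 ltW.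
  + exists M => w; rewrite ler_pdivrMr//; have := zM w; have := z_ge0 w.
    have := x_ge0 w; rewrite /r; nra.
  + move=> g Kg; have := le1 _ (K'D _ Kg); congr (_ <= _)%E.
    by apply: eq_integral => w _; congr (_%:E); ring.
  + move: gt1; congr (_ < _)%E.
    by apply: eq_integral => w _; congr (_%:E); ring.
Qed.

End separation.

(** * Quasi-sure relations, expectations and order limits through representatives *)

Section quasi_sure_calculus.
Context {d : measure_display} {Omega : measurableType d} {R : realType}.
Context {PP : set (probability Omega R)} (hP : PP !=set0).
Implicit Types (Q : probability Omega R) (f g : {mfun Omega >-> R}).
Implicit Types (X Y Z : L0c hP).

(** A countable union of polar sets is polar, being null under every member of [PP]. *)
Lemma quasi_surely_forall (A : nat -> Omega -> Prop) :
  (forall n, quasi_surely PP [set w | A n w]) ->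
  quasi_surely PP [set w | forall n, A n w].
Proof.
move=> qA.
have /choice[N N_polar] : forall n, exists N,
    polar PP N /\ ~` N `<=` [set w | A n w].
  by move=> n; have [N pN NA] := qA n; exists N.
exists (\bigcup_n N n).
  apply/polarP => //; split=> [|P PPP].
    by apply: bigcup_measurable => n _; case: (N_polar n) => -[].
  apply: measure_negligible.
    by apply: bigcup_measurable => n _; case: (N_polar n) => -[].
  apply: negligible_bigcup => n.
  by case: (N_polar n) => /(polarP _ hP)[mN NP] _; apply/negligibleP => //; exact: NP.
by move=> w Nw n; apply: (N_polar n).2 => Nnw; apply: Nw; exists n.
Qed.

Lemma quasi_surely_ae Q (A : Omega -> Prop) : abs_cont_prob PP Q ->
  quasi_surely PP [set w | A w] -> {ae Q, forall w, A w}.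
Proof.
move=> QP [N pN NA]; exists N; split; [by case: pN|exact: QP|].
by move=> w; apply: contra_notP => Nw; exact: NA.
Qed.

Lemma jQ_eqP Q X Y : jQ Q X = jQ Q Y <-> {ae Q, forall w, X w = Y w}.
Proof.
rewrite /jQ; split=> [/eqP|XY].
  by rewrite eqmodE => /asboolP; apply: filterS => w; apply.
by apply/eqP; rewrite eqmodE; apply/asboolP; apply: filterS XY.
Qed.

Lemma L0c_le_pi f g : (\pi_(L0c hP) f <= \pi_(L0c hP) g) <->
  quasi_surely PP [set w | f w <= g w].
Proof.
have qfg := quasi_surelyI hP (L0c_repr_pi hP f) (L0c_repr_pi hP g).
split=> [/L0c_leP|] h; last apply/L0c_leP.
  by apply: quasi_surelyS (quasi_surelyI hP h qfg) => w /= [+ [fE gE]]; rewrite fE gE.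
by apply: quasi_surelyS (quasi_surelyI hP h qfg) => w /= [+ [fE gE]]; rewrite fE gE.
Qed.

Lemma L0c_ge0P X : 0 <= X <-> quasi_surely PP [set w | 0 <= X w].
Proof. by rewrite -[X in _ <= X]reprK; exact: (L0c_le_pi 0). Qed.

(** The positive part of the canonical representative serves, and makes pointwise arguments
    available. *)
Lemma L0c_ge0_repr X : 0 <= X ->
  exists2 f, X = \pi_(L0c hP) f & forall w, 0 <= f w.
Proof.
move=> /L0c_ge0P X_ge0; exists (max_mfun X (cst 0)); last first.
  by move=> w; rewrite le_max lexx orbT.
rewrite -[LHS]reprK; apply/L0c_piP; apply: quasi_surelyS X_ge0 => w /= X0.
by rewrite max_l.
Qed.

Lemma L0c_abs_pi f :
  L0c_abs (\pi_(L0c hP) f) = \pi_(L0c hP) [the {mfun Omega >-> R} of Num.norm \o f].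
Proof.
apply/L0c_piP; apply: quasi_surelyS (L0c_repr_pi hP f) => w /= fE.
by congr Num.norm.
Qed.

Lemma Linfty_pos_pi f M : (forall w, 0 <= f w) -> (forall w, f w <= M) ->
  Linfty_pos (\pi_(L0c hP) f).
Proof.
move=> f_ge0 fM; split; last first.
  by apply/(L0c_le_pi 0); apply: quasi_surelyS (quasi_surelyT hP) => w _; exact: f_ge0.
(* The bound in [Linfty] has to be positive, and [M] may be [0]. *)
exists (Num.max M 1); first by rewrite lt_max ltr01 orbT.
rewrite L0c_abs_pi; apply/L0c_le_pi.
apply: quasi_surelyS (quasi_surelyT hP) => w _ /=.
by rewrite ger0_norm// le_max fM.
Qed.

Lemma E_cM_pi Q f g : abs_cont_prob PP Q ->
  (E_c Q (\pi_(L0c hP) f * \pi_(L0c hP) g)%R = \int[Q]_w (f w * g w)%:E)%E.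
Proof.
move=> QP; rewrite [X in E_c Q X](L0c_pi_mul hP f g) E_c_pi//.
by rewrite unlock.
Qed.

(** Makes each polar constraint a condition on the [Q]-class of [X] alone. *)
Lemma eq_E_cM Q X Y Z : abs_cont_prob PP Q -> jQ Q X = jQ Q Y ->
  E_c Q (Z * X) = E_c Q (Z * Y).
Proof.
move=> QP /jQ_eqP XY; rewrite -[X]reprK -[Y]reprK -[Z]reprK !E_cM_pi//.
apply: ae_eq_integral => //.
- by apply/measurable_EFinP/measurable_funM; exact: measurable_funPT.
- by apply/measurable_EFinP/measurable_funM; exact: measurable_funPT.
- by apply: filterS XY => w XYw _; rewrite [repr X w]XYw.
Qed.

(** The pointwise infimum of the dominating sequence is measurable, so it defines a lower bound in
    [L0c] and is quasi-surely at most [0]; a decreasing sequence bounded below converges to its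
    infimum. *)
Lemma order_cvg_quasi_surely (X_ : nat -> L0c hP) X : order_cvg X_ X ->
  quasi_surely PP [set w | X_ n w @[n --> \oo] --> X w].
Proof.
move=> [Y_ [Y_dec [Y_ge0 Y_inf] XY]].
have qge0 : quasi_surely PP [set w | forall n, 0 <= Y_ n w].
  by apply: quasi_surely_forall => n; apply/L0c_ge0P; apply: Y_ge0; exists n.
have qdec : quasi_surely PP [set w | forall n, Y_ n.+1 w <= Y_ n w].
  by apply: quasi_surely_forall => n; apply/L0c_leP; exact: Y_dec.
have qXY : quasi_surely PP [set w | forall n, `|X_ n w - X w| <= Y_ n w].
  apply: quasi_surely_forall => n; have := XY n.
  rewrite -[X_ n]reprK -[X in L0c_abs (_ - X)]reprK -[Y_ n]reprK.
  rewrite [X in L0c_abs (_ + X)]L0c_pi_opp [X in L0c_abs X]L0c_pi_add.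
  rewrite L0c_abs_pi => /L0c_le_pi; apply: quasi_surelyS => w.
  by rewrite !reprK; exact.
(* Positive parts bound the sequence from below everywhere, so that the real infimum is meaningful
   off the quasi-sure event too. *)
pose v n w : R := Num.max (Y_ n w) 0.
have v_ge0 n w : 0 <= v n w by rewrite le_max lexx orbT.
have mi : measurable_fun setT (fun w => infs (v^~ w) 0).
  apply: measurable_fun_infs => [w _|n]; first by exists 0 => _ [n _ <-].
  by apply: measurable_maxr => //; exact: measurable_funPT.
have i_le n w : infs (v^~ w) 0 <= v n w.
  by apply: ge_inf; [exists 0 => _ [k _ <-]|exists n].
have qi : quasi_surely PP [set w | infs (v^~ w) 0 <= 0].
  suff : \pi_(L0c hP) (mfun_Sub (mem_set mi)) <= 0 by move/(L0c_le_pi _ 0).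
  apply: Y_inf => _ [n _ <-]; rewrite -[Y_ n]reprK; apply/L0c_le_pi.
  apply: quasi_surelyS qge0 => w /= /(_ n) Yn.
  by apply: le_trans (i_le n w) _; rewrite /v max_l.
have q := quasi_surelyI hP (quasi_surelyI hP qge0 qdec) (quasi_surelyI hP qXY qi).
apply: quasi_surelyS q => w /= [[ge0 dec] [le_Y inf_le0]].
have Y0 : Y_ n w @[n --> \oo] --> (0 : R).
  have <- : inf (range (fun n => Y_ n w)) = 0.
    apply/eqP; rewrite eq_le; apply/andP; split.
      apply: le_trans inf_le0; apply: lb_le_inf; first by exists (v 0%N w), 0%N.
      move=> _ [n _ <-]; rewrite /v max_l//.
      by apply: ge_inf; [exists 0 => _ [k _ <-]|exists n].
    by apply: lb_le_inf; [exists (Y_ 0%N w), 0%N|move=> _ [n _ <-]].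
  apply: nonincreasing_cvgn; last by exists 0 => _ [n _ <-].
  by apply/nonincreasing_seqP.
apply/cvgrPdist_le => eps eps_gt0; near=> n.
rewrite distrC; apply: le_trans (le_Y n) _; apply: le_trans (ler_norm _) _.
by near: n; exact: (cvgr0_norm_le _ Y0).
Unshelve. all: by end_near. Qed.

(** The sequence [f - u n] dominates. A lower bound of its classes is quasi-surely below all
    [f - u n] at once, by countability, hence below their limit [0]. *)
Lemma nondecreasing_order_cvg (u : nat -> {mfun Omega >-> R}) f :
  (forall w, nondecreasing_seq (fun n => u n w)) ->
  (forall w, u n w @[n --> \oo] --> f w) ->
  order_cvg (fun n => \pi_(L0c hP) (u n)) (\pi_(L0c hP) f).
Proof.
move=> u_inc uf.
have u_le n w : u n w <= f w.
  rewrite -(cvg_lim _ (uf w))//; apply: nondecreasing_cvgn_le => //.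
  by apply/cvg_ex; exists (f w).
exists (fun n => \pi_(L0c hP) (f - u n)); split.
- move=> m n mn; apply/L0c_le_pi; apply: quasi_surelyS (quasi_surelyT hP) => w _ /=.
  by rewrite lerB//; exact: u_inc.
- split.
    move=> _ [n _ <-]; apply/(L0c_le_pi 0).
    by apply: quasi_surelyS (quasi_surelyT hP) => w _ /=; rewrite subr_ge0.
  move=> L lbL; rewrite -[L]reprK; apply/(L0c_le_pi _ 0).
  have qL : quasi_surely PP [set w | forall n, repr L w <= f w - u n w].
    apply: quasi_surely_forall => n; apply/(L0c_le_pi _ (f - u n)).
    by rewrite reprK; apply: lbL; exists n.
  apply: quasi_surelyS qL => w /= Lw.
  have c : f w - u n w @[n --> \oo] --> f w - f w.
    by apply: cvgB; [exact: cvg_cst|exact: uf].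
  by rewrite subrr in c; apply: cvgr_to_ge c _; exact: nearW.
- move=> n; rewrite [X in L0c_abs (_ + X)]L0c_pi_opp [X in L0c_abs X]L0c_pi_add.
  rewrite L0c_abs_pi; apply/L0c_le_pi.
  apply: quasi_surelyS (quasi_surelyT hP) => w _ /=.
  by rewrite distrC ger0_norm// subr_ge0.
Qed.

End quasi_sure_calculus.

(** Fatou's lemma, [f] being a.e. the lower limit of [u]. *)
Lemma ae_fatou_le {d : measure_display} {Omega : measurableType d}
    {R : realType} (Q : probability Omega R) (u : nat -> Omega -> R)
    (f : Omega -> R) (a : \bar R) :
  (forall n, measurable_fun setT (u n)) -> measurable_fun setT f ->
  (forall n w, 0 <= u n w) -> {ae Q, forall w, u n w @[n --> \oo] --> f w} ->
  (forall n, \int[Q]_w (u n w)%:E <= a)%E -> (\int[Q]_w (f w)%:E <= a)%E.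
Proof.
move=> mu mf u_ge0 uf le_a.
have muE n : measurable_fun setT (fun w => (u n w)%:E) by exact/measurable_EFinP.
have -> : (\int[Q]_w (f w)%:E = \int[Q]_w limn_einf (fun n => (u n w)%:E))%E.
  apply: ae_eq_integral => //; first exact/measurable_EFinP.
    apply: measurableT_comp => //; apply: measurable_fun_limn_esup => n.
    by apply: measurableT_comp => //; exact: muE.
  apply: filterS uf => w ufw _; apply/esym.
  have ufwE : (u n w)%:E @[n --> \oo] --> (f w)%:E.
    by apply: cvg_EFin; [exact: nearW|exact: ufw].
  by have [] := cvg_limn_einf_sup ufwE.
apply: le_trans (fatou Q measurableT muE _) _.
  by move=> n w _; rewrite lee_fin.
rewrite limn_einf_lim; apply: lime_le; first exact: is_cvg_einfs.
apply: nearW => n; apply: le_trans (le_a n).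
by apply: ereal_inf_lbound; exists n => /=.
Qed.

(** * Bipolars in [L0c] *)

Section bipolar.
Context {d : measure_display} {Omega : measurableType d} {R : realType}.
Context {PP : set (probability Omega R)} (hP : PP !=set0).
Implicit Types (Q : probability Omega R) (f g : {mfun Omega >-> R}).
Implicit Types (X Y Z : L0c hP) (C : set (L0c hP)).

Lemma convex_setP C : convex_set C <-> forall X Y (t : R), C X -> C Y ->
  0 <= t -> t <= 1 -> C (t *: X + (1 - t) *: Y).
Proof.
split=> [cC X Y t CX CY t0 t1|cC X Y t /set_mem CX /set_mem CY].
  by have /set_mem := cC X Y (Itv01 t0 t1) (mem_set CX) (mem_set CY).
by apply/mem_set; exact: cC.
Qed.

Lemma L0c_pi_conv f g (t : R) :
  t *: \pi_(L0c hP) f + (1 - t) *: \pi_(L0c hP) g = \pi_(L0c hP) (t *: f + (1 - t) *: g).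
Proof.
rewrite [X in X + _]L0c_pi_scale [X in _ + X]L0c_pi_scale.
exact: L0c_pi_add.
Qed.

Definition pos_repr C : set (Omega -> R) :=
  [set f | (forall w, 0 <= f w) /\
           exists2 g : {mfun Omega >-> R}, f = g & C (\pi_(L0c hP) g)].

(** Increasing pointwise limits are order limits of the classes, so sequential order closedness
    yields [mcc_closed]. *)
Lemma pos_reprP C : convex_set C -> solid C -> seq_order_closed C ->
  monotone_closed_convex (pos_repr C).
Proof.
move=> /convex_setP cC sC oC; split.
- by move=> _ [_ [g -> _]]; exact: measurable_funPT.
- by move=> f [].
- move=> f' g' t [f0 [f fE Cf]] [g0 [g gE Cg]] t0 t1; subst f' g'; split.
    by move=> w; rewrite addr_ge0// mulr_ge0// subr_ge0.
  exists (t *: f + (1 - t) *: g); first by apply/funext => w.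
  by rewrite -L0c_pi_conv; exact: cC.
- move=> f' g [f0 [f fE Cf]] mg g0 gf; subst f'; split=> //.
  exists (mfun_Sub (mem_set mg)) => //; apply: sC Cf _ _.
    by apply/(L0c_le_pi _ 0); apply: quasi_surelyS (quasi_surelyT hP) => w _; exact: g0.
  by apply/L0c_le_pi; apply: quasi_surelyS (quasi_surelyT hP) => w _; exact: gf.
- move=> u f Ku u_inc uf.
  have /choice[v uv] : forall n, exists g : {mfun Omega >-> R},
      u n = g /\ C (\pi_(L0c hP) g).
    by move=> n; have [_ [g ug Cg]] := Ku n; exists g.
  have mf : measurable_fun setT f.
    apply: (@measurable_fun_cvg _ _ _ _ u) => [n|w _]; last exact: uf.
    by rewrite (uv n).1; exact: measurable_funPT.
  split.
    move=> w; apply: cvgr_to_ge (uf w) _; apply: nearW => n.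
    by have [] := Ku n.
  exists (mfun_Sub (mem_set mf)) => //.
  apply: (oC (fun n => \pi_(L0c hP) (v n))); first by move=> n; case: (uv n).
  apply: nondecreasing_order_cvg => w.
    by move=> m n mn; rewrite -(uv m).1 -(uv n).1; exact: u_inc.
  by rewrite (_ : (fun n => v n w) = (u^~ w))//; apply/funext => n; rewrite (uv n).1.
Qed.

(** It suffices to find, for each [Q] in [QQ], a member of [C] that is [Q]-a.s. equal to [X]. If
    there is none, separation gives a density in the polar that excludes [X]. *)
Lemma bipolar_set_sub (QQ : set (probability Omega R)) C :
  C `<=` L0c_pos hP -> C !=set0 -> convex_set C -> solid C ->
  seq_order_closed C -> reduction_set QQ C -> bipolar_set QQ C `<=` C.
Proof.
move=> C_pos C_neq0 cC sC oC [QQ0 QQP CE] X [X_ge0 X_le1].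
rewrite CE => Q QQQ.
have [x XE x_ge0] := L0c_ge0_repr X_ge0.
have K_neq0 : pos_repr C !=set0.
  case: C_neq0 => Y CY; have [y YE y_ge0] := L0c_ge0_repr (C_pos _ CY).
  by exists y; split=> //; exists y => //; rewrite -YE.
have QP := QQP _ QQQ.
have [[_ [_ [y -> Cy]] yx]|[z [mz z_ge0 [M zM] le1 gt1]]] :=
  separation Q (pos_reprP cC sC oC) K_neq0 (measurable_funPT x) x_ge0.
  exists (\pi_(L0c hP) y) => //; apply/jQ_eqP; rewrite XE.
  have := quasi_surely_ae QP (quasi_surelyI hP (L0c_repr_pi hP x) (L0c_repr_pi hP y)).
  by apply: filterS2 yx => w /= yxw [xE yE]; rewrite xE yE.
pose Z := \pi_(L0c hP) (mfun_Sub (mem_set mz)).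
have : (1 < E_c Q (Z * X)%R)%E by rewrite XE E_cM_pi.
rewrite ltNge (X_le1 (Q, Z))//; split=> //=.
  exact: (@Linfty_pos_pi _ _ _ _ hP (mfun_Sub (mem_set mz)) M).
move=> Y CY; have [y YE y_ge0] := L0c_ge0_repr (C_pos _ CY).
by rewrite YE E_cM_pi//; apply: le1; split=> //; exists y => //; rewrite -YE.
Qed.

Lemma sub_bipolar_set (QQ : set (probability Omega R)) C :
  C `<=` L0c_pos hP -> C `<=` bipolar_set QQ C.
Proof. by move=> C_pos X CX; split=> [|QZ [_ _]]; [exact: C_pos|exact]. Qed.

Lemma sensitive_reduction_set C : sensitive C -> reduction_set (abs_cont_prob PP) C.
Proof.
move=> sC; split=> //; case: hP => P PPP; exists P => N.
by move=> /(polarP _ hP)[_]; exact.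
Qed.

Lemma bipolar_set_mono (QQ : set (probability Omega R)) C D :
  C `<=` D -> bipolar_set QQ C `<=` bipolar_set QQ D.
Proof.
move=> CD X [X_ge0 le1]; split=> // QZ [QQQ Z_pos leD]; apply: le1; split=> //.
by move=> Y /CD; exact: leD.
Qed.

(** Each constraint is convex and monotone in [X], passes to order limits by Fatou's lemma, and
    depends only on the [Q]-class of [X]. *)
Lemma bipolar_set_class C : bipolar_class (bipolar_set (abs_cont_prob PP) C).
Proof.
split.
- apply/convex_setP => X Y t [X_ge0 X_le1] [Y_ge0 Y_le1] t0 t1.
  have [x XE x_ge0] := L0c_ge0_repr X_ge0; have [y YE y_ge0] := L0c_ge0_repr Y_ge0.
  have t1' : 0 <= 1 - t by rewrite subr_ge0.
  rewrite XE YE L0c_pi_conv; split.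
    apply/(L0c_le_pi _ 0); apply: quasi_surelyS (quasi_surelyT hP) => w _ /=.
    by rewrite addr_ge0// mulr_ge0.
  move=> [Q Z] QZ; have [/= QP [_ Z_ge0] _] := QZ.
  have [z ZE z_ge0] := L0c_ge0_repr Z_ge0.
  have := X_le1 _ QZ; have := Y_le1 _ QZ; rewrite /= XE YE ZE !E_cM_pi// => yle1 xle1.
  have mzx : measurable_fun setT (fun w => (z w * x w)%:E).
    by apply/measurable_EFinP/measurable_funM; exact: measurable_funPT.
  have mzy : measurable_fun setT (fun w => (z w * y w)%:E).
    by apply/measurable_EFinP/measurable_funM; exact: measurable_funPT.
  rewrite (_ : (\int[Q]_w _ = \int[Q]_w (t%:E * (z w * x w)%:E +
      (1 - t)%:E * (z w * y w)%:E))%E); last first.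
    apply: eq_integral => w _; rewrite -!EFinM -EFinD; congr (_%:E).
    transitivity (z w * (t * x w + (1 - t) * y w)); [by []|ring].
  rewrite ge0_integralD//; first last.
  + exact: measurable_funeM.
  + by move=> w _; rewrite mule_ge0// lee_fin// mulr_ge0.
  + exact: measurable_funeM.
  + by move=> w _; rewrite mule_ge0// lee_fin// mulr_ge0.
  rewrite !ge0_integralZl//; try by move=> w _; rewrite lee_fin mulr_ge0.
  rewrite (_ : 1%E = t%:E * 1 + (1 - t)%:E * 1)%E.
    by apply: leeD; apply: lee_wpmul2l.
  by rewrite !mule1 -EFinD; congr (_%:E); ring.
- move=> X Y [X_ge0 X_le1] Y_ge0 YX; split=> // -[Q Z] QZ.
  have [/= QP [_ Z_ge0] _] := QZ.
  have [z ZE z_ge0] := L0c_ge0_repr Z_ge0.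
  have [x XE x_ge0] := L0c_ge0_repr X_ge0; have [y YE y_ge0] := L0c_ge0_repr Y_ge0.
  have := X_le1 _ QZ; rewrite /= ZE XE YE !E_cM_pi//; apply: le_trans.
  apply: ae_ge0_le_integral => //.
  + by move=> w _; rewrite lee_fin mulr_ge0.
  + by apply/measurable_EFinP/measurable_funM; exact: measurable_funPT.
  + by move=> w _; rewrite lee_fin mulr_ge0.
  + by apply/measurable_EFinP/measurable_funM; exact: measurable_funPT.
  + rewrite YE XE in YX; have := quasi_surely_ae QP ((L0c_le_pi hP y x).1 YX).
    by apply: filterS => w yx _; rewrite lee_fin ler_wpM2l.
- move=> X_ X BX XX.
  have /choice[x_ xP] : forall n, exists x : {mfun Omega >-> R},
      X_ n = \pi_(L0c hP) x /\ forall w, 0 <= x w.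
    by move=> n; have [/L0c_ge0_repr[x XE x_ge0] _] := BX n; exists x.
  have xX : quasi_surely PP [set w | x_ n w @[n --> \oo] --> X w].
    have qx : quasi_surely PP [set w | forall n, X_ n w = x_ n w].
      by apply: (quasi_surely_forall hP) => n; rewrite (xP n).1; exact: L0c_repr_pi.
    apply: quasi_surelyS (quasi_surelyI hP qx (order_cvg_quasi_surely XX)).
    by move=> w [/= xE]; under eq_fun do rewrite xE.
  split.
    apply/L0c_ge0P; apply: quasi_surelyS xX => w /= xXw.
    by apply: cvgr_to_ge xXw _; apply: nearW => n; case: (xP n).
  move=> [Q Z] QZ; have [/= QP [_ Z_ge0] _] := QZ.
  have [z ZE z_ge0] := L0c_ge0_repr Z_ge0.
  rewrite ZE -[X]reprK E_cM_pi//.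
  apply: (@ae_fatou_le _ _ _ _ (fun n w => z w * x_ n w)).
  + by move=> n; apply: measurable_funM; exact: measurable_funPT.
  + by apply: measurable_funM; exact: measurable_funPT.
  + by move=> n w; rewrite mulr_ge0//; case: (xP n).
  + apply: filterS (quasi_surely_ae QP xX) => w /= xXw.
    by apply: cvgM; [exact: cvg_cst|exact: xXw].
  + move=> n; have [_ /(_ _ QZ)] := BX n; rewrite /= ZE (xP n).1 E_cM_pi//.
- apply/seteqP; split=> [X BX Q _|X BX]; first by exists X.
  split=> [|[Q Z] QZ].
    (* Positivity is tested on [PP] itself: under each [P] in [PP], [X] agrees a.s. with a
       nonnegative class, so the event [X < 0] is null for all of them, hence polar. *)
    apply/L0c_ge0P.
    have mN : measurable [set w | X w < 0].
      rewrite (_ : [set w | _] = setT `&` X @^-1` `]-oo, 0[%classic).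
        exact: measurable_funPT.
      by rewrite setTI; apply/seteqP; split=> w /=; rewrite in_itv.
    exists [set w | X w < 0]; last by move=> w /= /negP; rewrite -leNgt.
    apply/(polarP _ hP); split=> // P PPP.
    have PP_P : abs_cont_prob PP P.
      by move=> N /(polarP _ hP)[_]; exact.
    have [Y [/L0c_ge0P Y_ge0 _] /jQ_eqP YX] := BX P PP_P.
    apply: measure_negligible => //.
    have : {ae P, forall w, 0 <= X w}.
      by apply: filterS2 YX (quasi_surely_ae PP_P Y_ge0) => w /= ->.
    by apply: negligibleS => w /= Xw; apply/negP; rewrite -ltNge.
  have [/= QP _ _] := QZ; have [Y [_ Y_le1] YX] := BX Q QP.
  by rewrite -(eq_E_cM Z QP YX); exact: Y_le1 QZ.
Qed.

End bipolar.

(** * Minimality of the bipolar and its fixed points *)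

Theorem corollary6p2 (R : realType) (d : measure_display)
    (Omega : measurableType d) (PP : set (probability Omega R))
    (hP : PP !=set0) (C : set (L0c hP))
    (C_pos : C `<=` L0c_pos hP) (C_neq0 : C !=set0) :
  [/\ [/\ bipolar_set (abs_cont_prob PP) C `<=` L0c_pos hP,
          bipolar_class (bipolar_set (abs_cont_prob PP) C),
          C `<=` bipolar_set (abs_cont_prob PP) C &
          forall D : set (L0c hP),
            D `<=` L0c_pos hP -> bipolar_class D -> C `<=` D ->
            bipolar_set (abs_cont_prob PP) C `<=` D],
      C = bipolar_set (abs_cont_prob PP) C <-> bipolar_class C &
      forall QQ : set (probability Omega R),
        bipolar_class C -> reduction_set QQ C ->
        C = bipolar_set (abs_cont_prob PP) C /\
        bipolar_set (abs_cont_prob PP) C = bipolar_set QQ C].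
Proof.
have bipolarE (QQ : set (probability Omega R)) (D : set (L0c hP)) :
    D `<=` L0c_pos hP -> D !=set0 -> bipolar_class D -> reduction_set QQ D ->
    D = bipolar_set QQ D.
  move=> D_pos D0 [cD sD oD _] redD; apply/seteqP; split.
    exact: sub_bipolar_set.
  exact: bipolar_set_sub.
have bipolar_cE (D : set (L0c hP)) : D `<=` L0c_pos hP -> D !=set0 ->
    bipolar_class D -> D = bipolar_set (abs_cont_prob PP) D.
  move=> D_pos D0 bD; apply: bipolarE => //.
  by have [_ _ _ /sensitive_reduction_set] := bD.
split.
- split.
  + by move=> X [].
  + exact: bipolar_set_class.
  + exact: sub_bipolar_set.
  (* The bipolar is monotone and [D] equals its own; [D] is non-empty because it contains [C]. *)
  + move=> D D_pos bD CD; rewrite [D in _ `<=` D]bipolar_cE//.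
      exact: bipolar_set_mono.
    by case: C_neq0 => X /CD DX; exists X.
- split=> [->|]; [exact: bipolar_set_class|exact: bipolar_cE].
- move=> QQ bC redC; have CE := bipolar_cE _ C_pos C_neq0 bC.
  by split=> //; rewrite -CE; exact: bipolarE.
Qed.
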